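(* Let $(\Omega,\mathcal F,P)$ be a probability space and $(\theta_k)_{k\in\mathbb{Z}^d}$ a $d$-parameter group of $P$-preserving transformations such that $P$ is strongly mixing with respect to $(\theta_k)_{k\in\mathbb{Z}^d}$. Let $I$ be a set and $(k_n(t))_{n\in\mathbb{N}}$, $t\in I$, a family of $\mathbb{Z}^d$-valued sequences such that for all $m\in\mathbb{N}$ $$\lim_{n\to\infty}\frac1{n^2}\sup_{t\in I}\big|\{1\le i,j\le n:\ \|k_i(t)-k_j(t)\|\le m\}\big|=0.$$ Then for every $1\le p<\infty$ and every $f\in L^p(\Omega,\mathcal F,P)$, $$\sup_{t\in I}\Big\|\frac1n\sum_{i=0}^{n-1}f\circ\theta_{k_i(t)}-E[f]\Big\|_{L^p(P)}\to0\quad(n\to\infty).$$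
   Context: $\|\cdot\|$ is the maximum norm on $\mathbb{Z}^d$. A $d$-parameter group of $P$-preserving transformations: each $\theta_k$ measurable and $P$-preserving, $\theta_0=\mathrm{Id}$, $\theta_k\circ\theta_l=\theta_{k+l}$, $\theta_{-k}=\theta_k^{-1}$. $P$ is strongly mixing w.r.t. $(\theta_k)$ if $P(A\cap\theta_k^{-1}B)\to P(A)P(B)$ as $\|k\|\to\infty$, for all $A,B\in\mathcal F$. $E$ denotes expectation w.r.t. $P$. *)

(* Defs.v *)
From HB Require Import structures.
From mathcomp Require Import all_boot all_order all_algebra.
From mathcomp Require Import all_classical all_reals all_analysis.
Set Implicit Arguments. Unset Strict Implicit. Unset Printing Implicit Defensive.
Import Order.TTheory GRing.Theory Num.Theory.
Local Open Scope classical_set_scope.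
Local Open Scope ring_scope.

Definition maxnorm (d : nat) (k : 'rV[int]_d) : nat := \max_(i < d) `|k ord0 i|%N.

Definition pp_group (d : nat) (dd : measure_display) (T : measurableType dd)
    (R : realType) (P : probability T R) (theta : 'rV[int]_d -> T -> T) : Prop :=
  [/\ (forall k, measurable_fun setT (theta k)),
      (forall k A, measurable A -> P (theta k @^-1` A) = P A),
      theta 0 = id,
      (forall k l, theta k \o theta l = theta (k + l)) &
      (forall k, theta (- k) \o theta k = id /\ theta k \o theta (- k) = id)].

Definition strongly_mixing (d : nat) (dd : measure_display) (T : measurableType dd)
    (R : realType) (P : probability T R) (theta : 'rV[int]_d -> T -> T) : Prop :=
  forall A B, measurable A -> measurable B ->
  forall eps : R, 0 < eps -> exists M : nat, forall k : 'rV[int]_d,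
    (M < maxnorm k)%N ->
    (`| P (A `&` theta k @^-1` B) - P A * P B | < eps%:E)%E.

Definition close_pairs (d : nat) (I : Type) (ks : I -> nat -> 'rV[int]_d)
    (t : I) (n m : nat) : nat :=
  #|[set ij : 'I_n * 'I_n | (maxnorm (ks t ij.1.+1 - ks t ij.2.+1) <= m)%N]|.

(* Main.v *)
(** For an indicator, the second moment of the deviation is the average over
    pairs of times of the correlations [P (A /\ theta_l^-1 A) - P A ^ 2];
    mixing makes the distant pairs negligible and sparseness the close ones. The
    deviation is bounded by [1], so [L^2] convergence gives [L^p] convergence.
    The deviation operators have norm at most [2] on [L^p], so the convergence
    passes to simple functions by linearity and then to [L^p] by density, with
    all estimates uniform in the sequence of times. *)

Require Import Defs.
From HB Require Import structures.
From mathcomp Require Import all_boot all_order all_algebra.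
From mathcomp Require Import all_classical all_reals all_analysis.
From mathcomp Require Import measurable_realfun ring lra.
Import Order.TTheory GRing.Theory Num.Theory.
Local Open Scope classical_set_scope.
Local Open Scope ring_scope.
Set Implicit Arguments.
Unset Strict Implicit.
Import numFieldNormedType.Exports.

(** * The [L^p] seminorm of real functions: monotonicity, scaling, invariance, finite sums *)

Section Lnorm_extra.
Context (d : measure_display) (T : measurableType d) (R : realType).
Variables (mu : {measure set T -> \bar R}) (p : R).
Hypothesis p_ge1 : 1 <= p.
Implicit Types f g : T -> R.

Local Notation N f := (Lnorm mu p%:E (EFin \o f%R)).

Let p_gt0 : 0 < p. Proof. exact: lt_le_trans p_ge1. Qed.

Lemma measurable_normr_powR f : measurable_fun setT f ->
  measurable_fun setT (fun x => `|f x| `^ p).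
Proof.
move=> mf; apply: (@measurableT_comp _ _ _ _ _ _ (@powR R ^~ p)) => //.
exact: measurableT_comp.
Qed.

Lemma Lnorm_EFinE f : N f = ((\int[mu]_x (`|f x| `^ p)%:E) `^ p^-1)%E.
Proof. by rewrite unlock. Qed.

Lemma le_Lnorm f g : measurable_fun setT f -> measurable_fun setT g ->
  (forall x, `|f x| <= `|g x|) -> (N f <= N g)%E.
Proof.
move=> mf mg fg; rewrite !Lnorm_EFinE gt0_ler_poweR//.
- by rewrite invr_ge0 ltW.
- by rewrite in_itv/= leey integral_ge0// => x _; rewrite lee_fin powR_ge0.
- by rewrite in_itv/= leey integral_ge0// => x _; rewrite lee_fin powR_ge0.
apply: ge0_le_integral => //.
- exact/measurable_EFinP/measurable_normr_powR.
- exact/measurable_EFinP/measurable_normr_powR.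
- by move=> x _; rewrite lee_fin ge0_ler_powR// ?nnegrE// ltW.
Qed.

Lemma Lnorm_scale c f : measurable_fun setT f ->
  N (fun x => c * f x) = (`|c|%:E * N f)%E.
Proof.
move=> mf; rewrite !Lnorm_EFinE.
under eq_integral do rewrite normrM powRM// EFinM.
rewrite ge0_integralZl//; last exact/measurable_EFinP/measurable_normr_powR.
rewrite poweRM ?lee_fin ?powR_ge0//; last first.
  by apply: integral_ge0 => x _; rewrite lee_fin powR_ge0.
by rewrite poweR_EFin -powRrM divff ?gt_eqF// powRr1.
Qed.

(** Change of variables: the integral of [|f \o phi| ^ p] is that of [|f| ^ p] against the image
    measure, which is [mu] again. *)
Lemma Lnorm_comp (phi : T -> T) f : measurable_fun setT phi ->
  (forall A, measurable A -> mu (phi @^-1` A) = mu A) ->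
  measurable_fun setT f -> N (f \o phi) = N f.
Proof.
move=> mphi phiP mf; rewrite !Lnorm_EFinE; congr (_ `^ _)%E.
rewrite -[LHS](@ge0_integral_pushforward _ _ _ _ _ phi mphi mu setT
  (fun x => (`|f x| `^ p)%:E))//.
- apply: eq_measure_integral => A mA _; exact: phiP.
- exact/measurable_EFinP/measurable_normr_powR.
Qed.

Lemma Lnorm_sum (I : Type) (s : seq I) (F : I -> T -> R) :
  (forall i, measurable_fun setT (F i)) ->
  (N (fun x => \sum_(i <- s) F i x) <= \sum_(i <- s) N (F i))%E.
Proof.
move=> mF; elim: s => [|i s IH].
  rewrite big_nil (_ : EFin \o _ = cst 0%E).
    by rewrite Lnorm0// gt_eqF// lte_fin.
  by apply/funext => x /=; rewrite big_nil.
rewrite big_cons; under eq_Lnorm do rewrite /= big_cons.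
apply: le_trans (leeD2l _ IH).
apply: (@minkowski_EFin _ _ _ mu (F i) (fun x => \sum_(i <- s) F i x)) => //.
exact: measurable_sum.
Qed.

End Lnorm_extra.

(** * The [L^p] norm under a probability measure: constants and means *)

Section Lnorm_probability.
Context (d : measure_display) (T : measurableType d) (R : realType).
Variables (P : probability T R) (p : R).
Hypothesis p_ge1 : 1 <= p.
Implicit Types f g : T -> R.

Local Notation N f := (Lnorm P p%:E (EFin \o f%R)).

Let p_gt0 : 0 < p. Proof. exact: lt_le_trans p_ge1. Qed.

Lemma Lnorm_cst c : N (cst c) = `|c|%:E.
Proof.
rewrite Lnorm_EFinE /= integral_cst// [X in (_ * X)%E]probability_setT mule1.
by rewrite poweR_EFin -powRrM divff ?gt_eqF// powRr1.
Qed.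

Lemma Lnorm_lty_integrable f : measurable_fun setT f -> (N f < +oo)%E ->
  P.-integrable setT (EFin \o f).
Proof.
move=> mf Nf; apply/Lfun1_integrable.
apply: (@Lfun_subset _ _ _ P 1 p%:E) => //.
- by rewrite fin_num_measure.
- by rewrite inE; apply/andP; split; rewrite inE.
Qed.

(** The mean is bounded by the [L^1] norm, and the latter by the [L^p] norm: apply Hölder to [f] and
    the constant [1], which has norm [1] since the total mass is [1]. *)
Lemma normr_Rintegral_le_Lnorm f : measurable_fun setT f -> (N f < +oo)%E ->
  (`|\int[P]_x f x|%:E <= N f)%E.
Proof.
move=> mf Nf; have intf := Lnorm_lty_integrable mf Nf.
have h : (`|\int[P]_x f x|%:E <= Lnorm P 1%:E (EFin \o f))%E.
  rewrite EFin_normr_Rintegral// Lnorm1.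
  by apply: le_abse_integral => //; exact/measurable_EFinP.
apply: (le_trans h).
(* For [p = 1] the conjugate exponent is infinite, so this case is settled before Hölder. *)
move: p_ge1; rewrite le_eqVlt => /predU1P[<-//|p1].
have q1 : 0 < 1 - p^-1 by rewrite subr_gt0 invf_lt1.
have := @hoelder _ _ _ P f (cst 1) p (1 - p^-1)^-1 mf.
rewrite Lnorm_cst1 [X in (X `^ _)%E]probability_setT poweR_EFin powR1 mule1.
rewrite (_ : (f \* cst 1) = f); last by apply/funext => x /=; rewrite mulr1.
apply => //; first by rewrite invr_gt0.
by rewrite invrK subrKC.
Qed.

End Lnorm_probability.

(** Serves to discard the exponent [p] on quantities already known to be at most [1]. *)
Lemma powR_le_base (R : realType) (a r : R) :
  0 <= a <= 1 -> 1 <= r -> a `^ r <= a.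
Proof.
move=> /andP[]; rewrite le_eqVlt => /predU1P[<- _ r1|a0 a1 r1].
  by rewrite powR0// gt_eqF// (lt_le_trans _ r1).
by apply: ge1r_powR => //; rewrite a0.
Qed.

(** * Density of simple functions in the nonnegative part of [L^p] *)

Section Lnorm_density.
Context (d : measure_display) (T : measurableType d) (R : realType).
Variables (mu : {measure set T -> \bar R}) (p : R).
Hypothesis p_ge1 : 1 <= p.
Implicit Types f g : T -> R.

Local Notation N f := (Lnorm mu p%:E (EFin \o f%R)).

Let p_gt0 : 0 < p. Proof. exact: lt_le_trans p_ge1. Qed.

Lemma Lnorm_le_powR f (e : R) : 0 <= e ->
  (\int[mu]_x (`|f x| `^ p)%:E <= (e `^ p)%:E)%E -> (N f <= e%:E)%E.
Proof.
move=> e0 fe; rewrite Lnorm_EFinE.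
rewrite (_ : e%:E = ((e `^ p)%:E `^ p^-1)%E); last first.
  by rewrite poweR_EFin -powRrM divff ?gt_eqF// powRr1.
rewrite gt0_ler_poweR//.
- by rewrite invr_ge0 ltW.
- by rewrite in_itv/= leey integral_ge0// => x _; rewrite lee_fin powR_ge0.
- by rewrite in_itv/= leey lee_fin powR_ge0.
Qed.

Import HBSimple.
Import HBNNSimple.

(** The standard simple approximations satisfy [0 <= g n <= f] and converge pointwise to [f], so
    [|f - g n| ^ p] tends to [0] and is dominated by the integrable [|f| ^ p]; dominated convergence
    concludes. *)
Lemma nnsfun_dense_Lnorm f : measurable_fun setT f -> (forall x, 0 <= f x) ->
  (N f < +oo)%E -> forall e : R, 0 < e ->
  exists g : {nnsfun T >-> R}, (N (fun x => f x - g x) <= e%:E)%E.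
Proof.
move=> mf f0 Nf e e0.
have mEf : measurable_fun setT (EFin \o f) by exact/measurable_EFinP.
pose g n := nnsfun_approx measurableT mEf n.
have gf n x : g n x <= f x.
  rewrite /g nnsfun_approxE -lee_fin.
  by apply: (@le_approx _ _ _ setT (EFin \o f)) => // y _; rewrite lee_fin.
have gcvg x : g n x @[n --> \oo] --> f x.
  have := @cvg_nnsfun_approx _ _ _ _ measurableT _ mEf _ x I.
  by move=> /(_ (fun y _ => f0 y)) /fine_cvg.
have mfg n : measurable_fun setT (fun x => f x - g n x).
  by apply: measurable_funB => //; exact: measurable_funP.
have intf : mu.-integrable setT (fun x => (`|f x| `^ p)%:E).
  apply: Lfun_integrable => //.
  by rewrite inE; apply/andP; split; rewrite inE.
have : (\int[mu]_x (`|f x - g n x| `^ p)%:E @[n --> \oo] -->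
    \int[mu]_x (cst 0 x))%E.
  apply: (@dominated_cvg _ _ _ mu setT measurableT
    (fun n x => (`|f x - g n x| `^ p)%:E) (cst 0)%E _ _ _ _ intf) => //.
  - by move=> n; exact/measurable_EFinP/measurable_normr_powR.
  - move=> x _; apply: cvg_EFin; first exact: nearW.
    have d0 : `|f x - g n x| @[n --> \oo] --> (0 : R).
      rewrite -(normr0 R) -(subrr (f x)); apply: cvg_norm.
      by apply: cvgB; [exact: cvg_cst|exact: gcvg].
    apply: (@squeeze_cvgr _ _ _ _ (fun=> 0) (fun n => `|f x - g n x|)) => //;
      last exact: cvg_cst.
    (* Once [|f x - g n x| <= 1], its [p]-th power lies between [0] and the distance itself, so the
       squeeze applies. *)
    have /cvgrPdist_le/(_ _ ltr01) := d0.
    apply: filterS => n; rewrite sub0r normrN normr_id => h.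
    by rewrite powR_ge0 powR_le_base// normr_ge0.
  - move=> n x _; rewrite lee_fin ger0_norm ?powR_ge0//.
    rewrite ge0_ler_powR ?nnegrE ?(ltW p_gt0)// !ger0_norm//.
      by rewrite lerBlDr lerDl.
    by rewrite subr_ge0.
(* The integral is brought below [e ^ p], which becomes [e] after the [p]-th root. *)
rewrite integral0 => /fine_cvgP[fin0] /cvgrPdist_le/(_ (e `^ p)).
rewrite powR_gt0// => /(_ erefl) h.
have [n [fn hn]] := filter_ex (filterI fin0 h).
exists (g n); apply: Lnorm_le_powR; first exact: ltW.
rewrite -(fineK fn) lee_fin.
by move: hn; rewrite /= sub0r normrN; apply: le_trans; exact: ler_norm.
Qed.

End Lnorm_density.

(** * The deviation of an ergodic average from the mean, as a bounded linear operator *)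

Section deviation.
Context (R : realType) (dd : measure_display) (T : measurableType dd).
Variables (P : probability T R) (d : nat) (theta : 'rV[int]_d -> T -> T).
Hypothesis theta_pp : pp_group P theta.
Implicit Types (f g : T -> R) (k : nat -> 'rV[int]_d).

(** The average runs over times [k 0] to [k n.-1]. For [n = 0] the inverse is [0], so the value is
    minus the mean. *)
Definition deviation k n f x :=
  n%:R^-1 * \sum_(i < n) f (theta (k i) x) - \int[P]_y f y.

Lemma measurable_theta l : measurable_fun setT (theta l).
Proof. by case: theta_pp. Qed.

Lemma measure_theta l A : measurable A -> P (theta l @^-1` A) = P A.
Proof. by case: theta_pp => _ + _ _ _; exact. Qed.

Lemma measurable_deviation k n f : measurable_fun setT f ->
  measurable_fun setT (deviation k n f).
Proof.
move=> mf; apply: measurable_funB => //; apply: measurable_funM => //.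
apply: measurable_sum => i.
by apply: (measurableT_comp mf); exact: measurable_theta.
Qed.

Lemma deviationD k n f g :
  P.-integrable setT (EFin \o f) -> P.-integrable setT (EFin \o g) ->
  deviation k n (f \+ g) = deviation k n f \+ deviation k n g.
Proof.
move=> intf intg; apply/funext => x; rewrite /deviation /=.
by rewrite RintegralD// big_split/= mulrDr opprD addrACA.
Qed.

Lemma deviationZ k n c f : P.-integrable setT (EFin \o f) ->
  deviation k n (fun x => c * f x) = (fun x => c * deviation k n f x).
Proof.
move=> intf; apply/funext => x; rewrite /deviation /=.
by rewrite RintegralZl// -mulr_sumr mulrBr mulrCA.
Qed.

Variable p : R.
Hypothesis p_ge1 : 1 <= p.

Local Notation N f := (Lnorm P p%:E (EFin \o f%R)).

(** By invariance every [f \o theta (k i)] has the norm of [f], hence so does, at most, their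
    average; subtracting the mean costs one more [N f]. The bound depends on neither [k] nor [n],
    which keeps the later density argument uniform. *)
Lemma Lnorm_deviation_le k n f : measurable_fun setT f -> (N f < +oo)%E ->
  (N (deviation k n f) <= 2%:E * N f)%E.
Proof.
move=> mf Nf.
have mfi i : measurable_fun setT (fun x => f (theta (k i) x)).
  by apply: (measurableT_comp mf); exact: measurable_theta.
have Nfi i : N (fun x => f (theta (k i) x)) = N f.
  rewrite -[RHS](@Lnorm_comp _ _ _ P p (theta (k i)))//.
    exact: measurable_theta.
  by move=> A; exact: measure_theta.
have msum : measurable_fun setT (fun x => \sum_(i < n) f (theta (k i) x)).
  by apply: measurable_sum => i.
have -> : deviation k n f =
    (fun x => n%:R^-1 * \sum_(i < n) f (theta (k i) x)) \+
    cst (- \int[P]_y f y) by [].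
apply: le_trans; first apply: minkowski_EFin => //.
  exact: measurable_funM.
have -> : (2%:E * N f = N f + N f)%E.
  by rewrite (mule_natl _ 2) mule2n.
apply: leeD; last first.
  by rewrite Lnorm_cst// normrN; exact: normr_Rintegral_le_Lnorm.
rewrite Lnorm_scale// normfV normr_nat.
have [->|n0] := posnP n; first by rewrite mulr0n invr0 mul0e Lnorm_ge0.
(* Spreading [N f] over [n] equal shares lets the factor [n^-1] cancel on both sides. *)
have nN : (N f = n%:R^-1%:E * (n%:R%:E * N f))%E.
  by rewrite muleA -EFinM mulVf ?mul1e// pnatr_eq0 gtn_eqF.
rewrite [leRHS]nN; apply: lee_wpmul2l; first by rewrite lee_fin.
apply: le_trans; first by apply: (Lnorm_sum P p_ge1) => i.
under eq_bigr do rewrite Nfi.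
by rewrite sumr_const card_ord mule_natl.
Qed.

End deviation.

(* [close_pairs] ranges over the times [1..n] whereas the averages use
   [0..n-1]; the term [n.*2] accounts for the pairs involving time [0]. *)
Lemma sum_close_pairs_le (d : nat) (I : Type) (ks : I -> nat -> 'rV[int]_d)
    (t : I) (n m : nat) :
  (\sum_(i < n) \sum_(j < n) (maxnorm (ks t i - ks t j) <= m) <=
   close_pairs ks t n m + n.*2)%N.
Proof.
pose b (i j : nat) : nat := (maxnorm (ks t i - ks t j) <= m)%N.
have b1 i j : (b i j <= 1)%N by exact: leq_b1.
have -> : close_pairs ks t n m = (\sum_(i < n) \sum_(j < n) b i.+1 j.+1)%N.
  rewrite pair_big/= /close_pairs -sum1_card big_mkcond/=.
  apply: eq_bigr => -[i j] _ /=; rewrite /b.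
  by case: ifPn => [/set_mem/= ->//|/negP nA]; case: leqP => // lem;
    case: nA; apply/mem_set.
rewrite -[X in (X <= _)%N]/(\sum_(i < n) \sum_(j < n) b i j)%N.
case: n => [|n]; first by rewrite big_ord0.
(* The row of time [0] contributes at most its length. Every other row has at most one pair in
   column [0]; the rest is a shifted sum bounded by the one for [close_pairs]. *)
rewrite big_ord_recl -addnn addnCA; apply: leq_add.
  rewrite -[X in (_ <= X)%N]card_ord -sum1_card.
  by apply: leq_sum => j _; exact: b1.
apply: (@leq_trans (\sum_(i < n) (\sum_(j < n.+1) b i.+1 j.+1 + 1))%N).
  apply: leq_sum => i _; rewrite big_ord_recl addnC leq_add//.
  by rewrite [X in (_ <= X)%N]big_ord_recr/= leq_addr.
rewrite big_split/= sum1_card card_ord leq_add//.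
by rewrite [X in (_ <= X)%N]big_ord_recr/= leq_addr.
Qed.

(** * Integrals of bounded functions, finite sums and indicators *)

Section bounded_integrals.
Context (R : realType) (dd : measure_display) (T : measurableType dd).
Variable P : probability T R.

Lemma bounded_integrable (f : T -> R) c : measurable_fun setT f ->
  (forall x, `|f x| <= c) -> P.-integrable setT (EFin \o f).
Proof.
move=> mf fc.
apply: (le_integrable measurableT _ _
  (finite_measure_integrable_cst P c measurableT)).
  exact/measurable_EFinP.
by move=> x _ /=; rewrite lee_fin (le_trans (fc x))// ler_norm.
Qed.

Lemma Rintegral_sum (I : Type) (s : seq I) (F : I -> T -> R) :
  (forall i, P.-integrable setT (EFin \o F i)) ->
  \int[P]_x (\sum_(i <- s) F i x) = \sum_(i <- s) \int[P]_x F i x.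
Proof.
move=> iF; rewrite /Rintegral; under eq_integral do rewrite -sumEFin.
rewrite (integral_sum measurableT iF) -sum_fine// => i _.
exact: (integrable_fin_num measurableT (iF i)).
Qed.

Lemma Rintegral_indic A : measurable A -> \int[P]_x \1_A x = fine (P A).
Proof. by move=> mA; rewrite /Rintegral integral_indic// setIT. Qed.

End bounded_integrals.

(** * The second moment of the deviation of an indicator *)

Section indicator.
Context (R : realType) (dd : measure_display) (T : measurableType dd).
Variables (P : probability T R) (d : nat) (theta : 'rV[int]_d -> T -> T).
Hypothesis theta_pp : pp_group P theta.
Variables (A : set T) (mA : measurable A).
Implicit Types k : nat -> 'rV[int]_d.

Let a := fine (P A).

Let a01 : 0 <= a <= 1.
Proof.
rewrite /a -lee_fin -[X in _ && X]lee_fin fineK ?fin_num_measure//.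
by rewrite measure_ge0 probability_le1.
Qed.

Let centered k i x : R := \1_A (theta (k i) x) - a.

Let mtheta l : measurable (theta l @^-1` A).
Proof.
by rewrite -[_ @^-1` _]setTI; exact: (measurable_theta theta_pp).
Qed.

(** The mean is absorbed into the [n] summands, which requires [n] nonzero: at [n = 0] the left side
    is [- a] and the right side [0]. *)
Let deviation_indicE k n x : (0 < n)%N ->
  deviation P theta k n \1_A x = n%:R^-1 * \sum_(i < n) centered k i x.
Proof.
move=> n0; rewrite /deviation Rintegral_indic// /centered sumrB sumr_const.
by rewrite card_ord mulrBr -/a -[a *+ n]mulr_natl mulKf// pnatr_eq0 gtn_eqF.
Qed.

Let centered_le1 k i x : `|centered k i x| <= 1.
Proof.
case/andP: a01 => a0 a1; rewrite /centered indicE ler_norml.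
by case: (_ \in _) => /=; lra.
Qed.

Lemma deviation_indic_le1 k n x : (0 < n)%N ->
  `|deviation P theta k n \1_A x| <= 1.
Proof.
move=> n0; rewrite deviation_indicE// normrM normfV normr_nat.
rewrite ler_pdivrMl ?ltr0n// mulr1 (le_trans (ler_norm_sum _ _ _))//.
rewrite -[leRHS]mulr1 mulr_natl -[in leRHS](card_ord n) -sumr_const.
by apply: ler_sum => i _.
Qed.

Let Rintegral_centeredM k i j :
  \int[P]_x (centered k i x * centered k j x) =
  fine (P (A `&` theta (k i - k j) @^-1` A)) - a * a.
Proof.
pose l := k i - k j.
have AE x : \1_A (theta (k i) x) * \1_A (theta (k j) x) =
    \1_(theta (k j) @^-1` (A `&` theta l @^-1` A)) x :> R.
  have -> : theta (k i) x = theta l (theta (k j) x).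
    case: theta_pp => _ _ _ /(_ l (k j)) + _.
    by rewrite /l subrK => <-.
  by rewrite preimage_setI indicI /= mulrC !indicE.
have mB : measurable (theta (k j) @^-1` (A `&` theta l @^-1` A)).
  rewrite -[X in measurable X]setTI; apply: (measurable_theta theta_pp) => //.
  exact: measurableI.
have Pj i' : \int[P]_x \1_A (theta (k i') x) = a.
  rewrite -[LHS]/(\int[P]_x \1_(theta (k i') @^-1` A) x).
  by rewrite Rintegral_indic// measure_theta.
have int1 B : measurable B -> P.-integrable setT (EFin \o (\1_B : T -> R)).
  by move=> mB'; exact: integrable_indic.
(* The product of the centered indicators is expanded; each cross term has integral [a * a], and one
   of them cancels against the constant. *)
transitivity (\int[P]_x (\1_(theta (k j) @^-1` (A `&` theta l @^-1` A)) x -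
   ((a * \1_(theta (k i) @^-1` A) x +
     a * \1_(theta (k j) @^-1` A) x) - a * a))).
  apply: eq_Rintegral => x _; rewrite -AE /centered.
  rewrite -[\1_(theta (k i) @^-1` A) x]/(\1_A (theta (k i) x)).
  rewrite -[\1_(theta (k j) @^-1` A) x]/(\1_A (theta (k j) x)).
  by ring.
have intZ i' : P.-integrable setT
    (EFin \o (fun x => a * \1_(theta (k i') @^-1` A) x)).
  by apply: (integrableZl measurableT a (int1 _ (mtheta (k i')))).
have intc : P.-integrable setT (EFin \o (fun=> a * a : R)).
  exact: finite_measure_integrable_cst.
have intD := integrableD measurableT (intZ i) (intZ j).
rewrite RintegralB//; [|exact: int1|exact: (integrableB measurableT intD intc)].
rewrite RintegralB//.
rewrite RintegralD// !RintegralZl//;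
  try by [exact: int1|exact: finite_measure_integrable_cst].
rewrite !Pj Rintegral_cst// Rintegral_indic//.
rewrite measure_theta//; last exact: measurableI.
have -> : fine (P setT) = 1 by rewrite probability_setT.
by rewrite mulr1 /l; ring.
Qed.

Let Rintegral_centeredM_le1 k i j :
  \int[P]_x (centered k i x * centered k j x) <= 1.
Proof.
rewrite Rintegral_centeredM; have mB := measurableI _ _ mA (mtheta (k i - k j)).
rewrite lerBlDr (@le_trans _ _ 1)//.
  by rewrite -lee_fin fineK ?fin_num_measure// probability_le1.
by rewrite lerDl mulr_ge0//; case/andP: a01.
Qed.

Let Rintegral_sqr_deviation k n : (0 < n)%N ->
  \int[P]_x (deviation P theta k n \1_A x ^+ 2) =
  n%:R^-1 ^+ 2 * \sum_(i < n) \sum_(j < n)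
    \int[P]_x (centered k i x * centered k j x).
Proof.
move=> n0.
have mc i : measurable_fun setT (centered k i).
  apply: measurable_funB => //.
  exact: (measurableT_comp _ (measurable_theta theta_pp _)).
have intc i j : P.-integrable setT
    (EFin \o (fun x => centered k i x * centered k j x)).
  apply: (@bounded_integrable _ _ _ _ _ 1); first exact: measurable_funM.
  by move=> x; rewrite normrM mulr_ile1.
have ints i : P.-integrable setT
    (EFin \o (fun x => \sum_(j < n) centered k i x * centered k j x)).
  rewrite (_ : EFin \o _ =
    (fun x => \sum_(j < n) (centered k i x * centered k j x)%:E)%E); last first.
    by apply/funext => x /=; rewrite sumEFin.
  by apply: (integrable_sum measurableT) => j _; exact: intc.
have intss : P.-integrable setT
    (EFin \o (fun x => \sum_(i < n) \sum_(j < n)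
      centered k i x * centered k j x)).
  rewrite (_ : EFin \o _ = (fun x => \sum_(i < n)
    (\sum_(j < n) centered k i x * centered k j x)%:E)%E); last first.
    by apply/funext => x /=; rewrite sumEFin.
  by apply: (integrable_sum measurableT) => i _; exact: ints.
have devE x : deviation P theta k n \1_A x ^+ 2 = n%:R^-1 ^+ 2 *
    \sum_(i < n) \sum_(j < n) centered k i x * centered k j x.
  rewrite deviation_indicE// exprMn [X in _ * X]expr2 mulr_suml.
  by congr (_ * _); apply: eq_bigr => i _; rewrite mulr_sumr.
under eq_Rintegral do rewrite devE.
rewrite RintegralZl// Rintegral_sum//; congr (_ * _).
by apply: eq_bigr => i _; rewrite Rintegral_sum.
Qed.

(** In the double sum of correlations, a pair at distance at most [M] (the diagonal included)
    contributes at most [1], and any other pair at most [e] by the mixing bound. *)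
Lemma second_moment_deviation_le k n M (e : R) : (0 < n)%N -> 0 <= e ->
  (forall l : 'rV[int]_d, (M < maxnorm l)%N ->
    (`|P (A `&` theta l @^-1` A) - P A * P A| < e%:E)%E) ->
  \int[P]_x (deviation P theta k n \1_A x ^+ 2) <=
  (\sum_(i < n) \sum_(j < n) (maxnorm (k i - k j)%R <= M))%N%:R / n%:R ^+ 2 + e.
Proof.
move=> n0 e0 mix; rewrite Rintegral_sqr_deviation// exprVn mulrC.
(* Writing [e] as [e * n ^ 2 / n ^ 2] gives each of the [n ^ 2] pairs its own [e], so the sums
   compare term by term. *)
rewrite -[X in _ + X](@mulfK _ (n%:R ^+ 2)); last first.
  by rewrite expf_neq0// pnatr_eq0 gtn_eqF.
rewrite -mulrDl ler_wpM2r ?invr_ge0 ?exprn_ge0//.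
have -> : e * n%:R ^+ 2 = \sum_(i < n) \sum_(j < n) e.
  by rewrite !sumr_const card_ord -mulrnA -[RHS]mulr_natr natrM expr2.
rewrite natr_sum -big_split/=; apply: ler_sum => i _.
rewrite natr_sum -big_split/=; apply: ler_sum => j _.
case: leqP => [_|/mix h].
  by rewrite (le_trans (Rintegral_centeredM_le1 _ _ _))// lerDl.
rewrite add0r Rintegral_centeredM /a.
have mB := measurableI _ _ mA (mtheta (k i - k j)).
move: h; rewrite -(fineK (fin_num_measure P _ mB)).
rewrite -(fineK (fin_num_measure P _ mA)).
rewrite -EFinM -EFinB abse_EFin lte_fin /= => /ltW.
by apply: le_trans; exact: ler_norm.
Qed.

End indicator.

(** * Functions with uniform mean convergence form a closed linear class *)

Section mean_ergodic.
Context (R : realType) (dd : measure_display) (T : measurableType dd).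
Variables (P : probability T R) (d : nat) (theta : 'rV[int]_d -> T -> T).
Variables (I : Type) (ks : I -> nat -> 'rV[int]_d).
Hypothesis theta_pp : pp_group P theta.
Variable p : R.
Hypothesis p_ge1 : 1 <= p.
Implicit Types f g : T -> R.

Local Notation N f := (Lnorm P p%:E (EFin \o f%R)).
Local Notation dev t n f := (deviation P theta (ks t) n f).

Let LnormD f g : measurable_fun setT f -> measurable_fun setT g ->
  (N (f \+ g) <= N f + N g)%E.
Proof. by move=> mf mg; exact: minkowski_EFin. Qed.

(** The threshold [n0] is chosen before [t], which encodes the supremum over [I]. Measurability and
    finite norm are bundled so that the class is stable under linear operations. *)
Definition mean_ergodic f :=
  [/\ measurable_fun setT f, (N f < +oo)%E &
    forall e : R, 0 < e -> exists n0 : nat, forall n : nat, (n0 <= n)%N ->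
      forall t : I, (N (dev t n f) <= e%:E)%E].

Lemma mean_ergodicD f g :
  mean_ergodic f -> mean_ergodic g -> mean_ergodic (f \+ g).
Proof.
move=> [mf Nf cf] [mg Ng cg]; split; first exact: measurable_funD.
  by apply: le_lt_trans (LnormD mf mg) _; rewrite lte_add_pinfty.
move=> e e0; have e2 : 0 < e / 2 by rewrite divr_gt0.
have [n1 h1] := cf _ e2; have [n2 h2] := cg _ e2.
exists (maxn n1 n2) => n; rewrite geq_max => /andP[n1n n2n] t.
rewrite deviationD; try exact: (Lnorm_lty_integrable p_ge1).
apply: le_trans (LnormD _ _) _; try exact: measurable_deviation.
by rewrite (splitr e) EFinD leeD// ?h1 ?h2.
Qed.

Lemma mean_ergodicZ c f : mean_ergodic f -> mean_ergodic (fun x => c * f x).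
Proof.
move=> [mf Nf cf]; split; first exact: measurable_funM.
  by rewrite Lnorm_scale// lte_mul_pinfty.
move=> e e0; have c1 : 0 < `|c| + 1 by rewrite ltr_pwDr.
(* Adding [1] keeps the divisor positive when [c = 0]. *)
have [|n0 h] := cf (e / (`|c| + 1)); first by rewrite divr_gt0.
exists n0 => n n0n t.
rewrite deviationZ; last exact: (Lnorm_lty_integrable p_ge1).
rewrite Lnorm_scale//; last exact: measurable_deviation.
apply: (@le_trans _ _ (`|c|%:E * (e / (`|c| + 1))%:E)%E).
  by apply: lee_wpmul2l; rewrite ?lee_fin// h.
by rewrite -EFinM lee_fin mulrCA ger_pMr// ler_pdivrMr// mul1r lerDl.
Qed.

Lemma mean_ergodic_sum (J : Type) (s : seq J) (F : J -> T -> R) :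
  (forall j, mean_ergodic (F j)) -> mean_ergodic (fun x => \sum_(j <- s) F j x).
Proof.
move=> mF; elim: s => [|j s IH].
  rewrite (_ : (fun=> _) = cst 0); last by apply/funext => x; rewrite big_nil.
  split=> [//||e e0]; first by rewrite Lnorm_cst// ltry.
  exists 0 => n _ t; rewrite (_ : dev t n (cst 0) = cst 0).
    by rewrite Lnorm_cst// normr0 lee_fin ltW.
  apply/funext => x; rewrite /deviation /cst/= Rintegral_cst// mul0r subr0.
  by rewrite big1// mulr0.
rewrite (_ : (fun=> _) = F j \+ (fun x => \sum_(j <- s) F j x)).
  exact: mean_ergodicD.
by apply/funext => x; rewrite big_cons.
Qed.

(** Split the deviation of [f] into those of [f - g] and [g]: the first is at most [2 * N (f - g)]
    for all [n] and [t], the second is uniformly small for large [n]. *)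
Lemma mean_ergodic_closure f : measurable_fun setT f -> (N f < +oo)%E ->
  (forall e : R, 0 < e ->
    exists2 g, mean_ergodic g & (N (fun x => f x - g x) <= e%:E)%E) ->
  mean_ergodic f.
Proof.
move=> mf Nf app; split=> // e e0.
(* The operator bound [2] turns an approximation error [e / 4] into [e / 2]. *)
have e4 : 0 < e / 4 by rewrite divr_gt0.
have e2 : 0 < e / 2 by rewrite divr_gt0.
have [g [mg Ng cg] fg] := app _ e4.
have [n0 h] := cg _ e2; exists n0 => n n0n t.
have mfg : measurable_fun setT (fun x => f x - g x) by exact: measurable_funB.
have Nfg : (N (fun x => f x - g x) < +oo)%E by rewrite (le_lt_trans fg)// ltry.
have -> : f = (fun x => f x - g x) \+ g.
  by apply/funext => x /=; rewrite subrK.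
rewrite deviationD; try exact: (Lnorm_lty_integrable p_ge1).
apply: le_trans (LnormD _ _) _; try exact: measurable_deviation.
rewrite (splitr e) EFinD leeD ?h//.
apply: le_trans (Lnorm_deviation_le theta_pp p_ge1 _ _ mfg Nfg) _.
apply: (@le_trans _ _ (2%:E * (e / 4)%:E)%E); first exact: lee_wpmul2l.
by rewrite -EFinM lee_fin; lra.
Qed.

(** * Mixing and sparseness give uniform convergence for indicators *)

Hypothesis theta_mixing : strongly_mixing P theta.
Hypothesis ks_sparse :
  forall m : nat, forall eps : R, 0 < eps -> exists N : nat, forall n : nat,
     (N <= n)%N -> forall t : I,
       (close_pairs ks t n m)%:R / (n%:R ^+ 2) <= eps.

Lemma second_moment_deviation_cvg A : measurable A -> forall e : R, 0 < e ->
  exists2 n0 : nat, (0 < n0)%N & forall n, (n0 <= n)%N -> forall t,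
    \int[P]_x (dev t n \1_A x ^+ 2) <= e.
Proof.
move=> mA e e0; have e3 : 0 < e / 3 by rewrite divr_gt0.
have [M mix] := theta_mixing mA mA e3.
have [n1 h1] := ks_sparse M e3.
(* Mixing and sparseness each use [e / 3]. The remaining third pays for the pairs involving time
   [0]: [n.*2 / n ^ 2 = 2 / n] is below [e / 3] as soon as [n > 6 / e]. *)
exists (maxn n1 (Num.truncn (6 / e)).+1); first by rewrite leq_max orbT.
move=> n; rewrite geq_max => /andP[n1n n2n] t.
have n0 : (0 < n)%N by exact: leq_ltn_trans n2n.
have nR : 0 < n%:R :> R by rewrite ltr0n.
have ne : 6 / e < n%:R.
  by rewrite (lt_le_trans (truncnS_gt _))// ler_nat.
apply: (le_trans
  (second_moment_deviation_le theta_pp mA (ks t) n0 (ltW e3) mix)).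
apply: (@le_trans _ _ ((close_pairs ks t n M + n.*2)%N%:R / n%:R ^+ 2 + e / 3)).
  rewrite lerD2r ler_wpM2r ?invr_ge0 ?exprn_ge0// ler_nat.
  exact: sum_close_pairs_le.
have h2 : n.*2%:R / n%:R ^+ 2 <= e / 3.
  rewrite (_ : _ / _ = 2 / n%:R); last first.
    by rewrite -muln2 natrM; field; rewrite gt_eqF.
  rewrite ler_pdivrMr//; move: ne; rewrite ltr_pdivrMr//; lra.
have := h1 n n1n t; rewrite natrD mulrDl; move: h2; lra.
Qed.

Lemma mean_ergodic_indic A : measurable A -> mean_ergodic \1_A.
Proof.
move=> mA; split => //.
  apply: le_lt_trans (@le_Lnorm _ _ _ P p p_ge1 _ (cst 1) _ _ _) _ => //.
    by move=> x; rewrite /cst/= indicE normr1 normr_nat lern1 leq_b1.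
  by rewrite Lnorm_cst// ltry.
(* With second moment at most [del ^ 2], the integral of [del + D ^ 2 / del] is at most
   [2 * del = e ^ p]. *)
move=> e e0; pose del := e `^ p / 2.
have del0 : 0 < del by rewrite divr_gt0// powR_gt0.
have [n0 n0_gt0 h] := second_moment_deviation_cvg mA (exprn_gt0 2 del0).
exists n0 => n n0n t; have n_gt0 : (0 < n)%N by exact: leq_trans n0n.
apply: Lnorm_le_powR => //; first exact: ltW.
pose D x := dev t n \1_A x.
have mD : measurable_fun setT D by apply: (measurable_deviation theta_pp).
have D1 x : `|D x| <= 1 by exact: deviation_indic_le1.
have intD2 : P.-integrable setT (EFin \o (fun x => D x ^+ 2)).
  apply: (@bounded_integrable _ _ _ _ _ 1); first exact: measurable_funX.
  by move=> x; rewrite normrX exprn_ile1.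
have intD2' : P.-integrable setT (EFin \o (fun x => del^-1 * D x ^+ 2)).
  exact: (integrableZl measurableT del^-1 intD2).
have intdel : P.-integrable setT (EFin \o (cst del)).
  exact: finite_measure_integrable_cst.
(* [`|D| `^ p <= `|D| <= del + D ^+ 2 / del] *)
apply: (@le_trans _ _ (\int[P]_x (del + del^-1 * D x ^+ 2)%:E)%E).
  apply: ge0_le_integral => //.
  - exact/measurable_EFinP/measurable_normr_powR.
  - apply/measurable_EFinP; apply: measurable_funD => //.
    by apply: measurable_funM => //; exact: measurable_funX.
  move=> x _; rewrite lee_fin.
  apply: le_trans (powR_le_base _ p_ge1) _; first by rewrite normr_ge0 D1.
  (* Above [del], multiplying [del <= |D|] by [|D|] gives [|D| <= D ^ 2 / del]. *)
  have [Dd|/ltW dD] := leP `|D x| del.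
    by rewrite (le_trans Dd)// lerDl mulr_ge0 ?sqr_ge0// invr_ge0 ltW.
  rewrite (@le_trans _ _ (del^-1 * D x ^+ 2))//; last by rewrite lerDr ltW.
  by rewrite ler_pdivlMl// -real_normK ?num_real// expr2 ler_wpM2r.
have -> : (\int[P]_x (del + del^-1 * D x ^+ 2)%:E =
    (\int[P]_x (del + del^-1 * D x ^+ 2)%R)%R%:E)%E.
  rewrite /Rintegral fineK//; apply: integrable_fin_num => //.
  exact: (integrableD measurableT intdel intD2').
rewrite lee_fin RintegralD// Rintegral_cst// RintegralZl//.
have -> : fine (P setT) = 1 by rewrite probability_setT.
rewrite mulr1 [leRHS]splitr lerD2l ler_pdivrMl//.
by rewrite -expr2 h.
Qed.

(** * From indicators to simple functions, then to all of [L^p] *)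

Import HBSimple.
Import HBNNSimple.

Lemma mean_ergodic_nnsfun (g : {nnsfun T >-> R}) : mean_ergodic g.
Proof.
have [m [c gE]] : exists m (c : nat -> R), forall x,
    g x = \sum_(i < m) c i * \1_(g @^-1` [set c i]) x.
  by eexists; eexists (fun i => _`_i); exact: fimfunEord.
rewrite (funext gE); apply: mean_ergodic_sum => i.
by apply: mean_ergodicZ; apply: mean_ergodic_indic; exact: measurable_funPTI.
Qed.

Lemma mean_ergodic_ge0 f : measurable_fun setT f -> (N f < +oo)%E ->
  (forall x, 0 <= f x) -> mean_ergodic f.
Proof.
move=> mf Nf f0; apply: mean_ergodic_closure => // e e0.
have [g gf] := nnsfun_dense_Lnorm p_ge1 mf f0 Nf e0.
by exists g => //; exact: mean_ergodic_nnsfun.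
Qed.

(** Positive and negative parts are dominated by [|f|], hence have finite norm, and linearity
    recombines them. *)
Lemma mean_ergodic_Lnorm_lty f : measurable_fun setT f -> (N f < +oo)%E ->
  mean_ergodic f.
Proof.
move=> mf Nf.
have mp := measurable_funrpos mf; have mn := measurable_funrneg mf.
have -> : f = f^\+ \+ (fun x => -1 * f^\- x).
  by apply/funext => x /=; rewrite mulN1r -[f in LHS]funrposBneg.
apply: mean_ergodicD; last apply: mean_ergodicZ; apply: mean_ergodic_ge0 => //.
- apply: le_lt_trans (le_Lnorm P p_ge1 mp mf _) Nf => x.
  rewrite ger0_norm ?funrpos_ge0//.
  by rewrite -[leRHS]/((Num.Def.normr \o f) x) -funrposDneg lerDl funrneg_ge0.
- apply: le_lt_trans (le_Lnorm P p_ge1 mn mf _) Nf => x.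
  rewrite ger0_norm ?funrneg_ge0//.
  by rewrite -[leRHS]/((Num.Def.normr \o f) x) -funrposDneg lerDr funrpos_ge0.
Qed.

End mean_ergodic.

Unset Implicit Arguments.

Theorem theorem4p8 (R : realType) (dd : measure_display) (T : measurableType dd)
  (P : probability T R) (d : nat) (theta : 'rV[int]_d -> T -> T)
  (I : Type) (ks : I -> nat -> 'rV[int]_d) :
  pp_group P theta ->
  strongly_mixing P theta ->
  (forall m : nat, forall eps : R, 0 < eps -> exists N : nat, forall n : nat,
     (N <= n)%N -> forall t : I,
       (close_pairs ks t n m)%:R / (n%:R ^+ 2) <= eps) ->
  forall (p : R) (f : T -> R), 1 <= p ->
    measurable_fun setT f ->
    (Lnorm P p%:E (EFin \o f) < +oo)%E ->
    forall eps : R, 0 < eps -> exists N : nat, forall n : nat, (N <= n)%N ->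
      forall t : I,
        (Lnorm P p%:E (fun x => ((n%:R)^-1 * \sum_(i < n) f (theta (ks t i) x)
                                 - fine (\int[P]_y (f y)%:E))%:E)
          <= eps%:E)%E.
Proof.
move=> theta_pp mixing sparse p f p_ge1 mf Nf.
(* The last component of [mean_ergodic] is the claim once [deviation] and the real integral are
   unfolded. *)
by have [] := mean_ergodic_Lnorm_lty theta_pp p_ge1 mixing sparse mf Nf.
Qed.
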